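(* Let $G$ be a simple subcubic graph, and suppose at most three edges of $G$ are properly precolored with colors from $\{1,2,3,4\}$. Then the precoloring can be extended to a proper $4$-edge-coloring of $G$.
   Context: A graph is subcubic if its maximum degree is at most $3$. A precoloring is a proper edge-coloring (adjacent edges receive distinct colors) of a subset of the edges; extending it means finding a proper edge-coloring of all of $G$ with the given colors that agrees with it on the precolored edges. *)

(* Defs.v *)
From mathcomp Require Import all_boot.

Set Implicit Arguments.
Unset Strict Implicit.
Unset Printing Implicit Defensive.

(* A finite simple graph is a symmetric irreflexive relation [e] on a finType. *)

Definition edges (T : finType) (e : rel T) : {set {set T}} :=
  [set [set x; y] | x in T, y in T & e x y].

Definition degree (T : finType) (e : rel T) (x : T) : nat := #|[set y | e x y]|.

Definition max_degree (T : finType) (e : rel T) : nat :=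
  \max_(x : T) degree e x.

Definition subcubic (T : finType) (e : rel T) : bool := max_degree e <= 3.

Definition adjacent_edges (T : finType) (f g : {set T}) : bool :=
  (f != g) && (f :&: g != set0).

(* Only the values of [c] on [F] matter, so a coloring of the edges in [F] is  *)
(* represented by a function on all sets of vertices.                          *)
Definition proper_edge_coloring (T : finType) (C : eqType)
    (F : {set {set T}}) (c : {set T} -> C) : Prop :=
  {in F &, forall f g, adjacent_edges f g -> c f != c g}.

(* Main.v *)
(** Induction on the number of edges. If an uncolored edge has an end of degree
   at most 2, it meets at most three other edges, so delete it and color it
   last. If the uncolored edges contain a cycle, color everything else first:
   each vertex [v] of the cycle then forbids a single color [a v], so a cycle
   edge [vw] has the list of colors other than [a v] and [a w]. Going around the
   cycle greedily works unless [a] alternates between two values, and then the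
   two remaining colors can be alternated as well. Otherwise the uncolored edges
   form a forest on [n] vertices all of degree 3; comparing the degree sum with
   the at most six ends of precolored edges forces [n = 4], so that we are in
   [K_4]. *)

Require Import Defs.
From mathcomp Require Import all_boot zify.

Set Implicit Arguments.
Unset Strict Implicit.
Unset Printing Implicit Defensive.

(* Cardinals of sets of sets occur in convertible forms that [lia] separates. *)
Ltac card_lia := unfold reverse_coercion in *; simpl in *; lia.

(** * Greedy choice among four colors *)

Definition fresh (s : seq 'I_4) : 'I_4 := odflt ord0 [pick c | c \notin s].

Lemma freshP (s : seq 'I_4) : size s <= 3 -> fresh s \notin s.
Proof.
move=> s3; rewrite /fresh; case: pickP => [//|all_s].
have : #|'I_4| <= #|s|.
  by apply/subset_leq_card/subsetP => c _; move/negbFE: (all_s c).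
by rewrite card_ord => /leq_trans/(_ (card_size s)); rewrite leqNgt ltnS s3.
Qed.

(** Index [i] stands for the cycle edge from vertex [i] to vertex [i.+1]. It avoids the colors
    forbidden at its two ends and the color of the preceding edge. *)
Fixpoint greedy (a : nat -> 'I_4) (d : 'I_4) (i : nat) : 'I_4 :=
  if i is j.+1 then fresh [:: a j.+1; a j.+2; greedy a d j] else d.

(* The last edge sees only three colors, since [a m.+1] repeats [a 0] or [d]. *)
Lemma cyclic_greedy (m : nat) (a : nat -> 'I_4) (d : 'I_4) :
    a m.+2 = a 0 -> d != a 0 -> d != a 1 -> a m.+1 \in [:: a 0; d] ->
  exists b : nat -> 'I_4,
    [/\ forall i, i < m.+2 -> (b i != a i) && (b i != a i.+1),
        forall i, i < m.+1 -> b i != b i.+1 & b m.+1 != b 0].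
Proof.
move=> a_per d0 d1 a_last.
pose l := fresh [:: a 0; d; greedy a d m].
have : l \notin [:: a 0; d; greedy a d m] by exact: freshP.
rewrite !inE !negb_or => /and3P[l0 ld lm].
have gP i : let b := greedy a d in
    [&& b i.+1 != a i.+1, b i.+1 != a i.+2 & b i.+1 != b i].
  have := @freshP [:: a i.+1; a i.+2; greedy a d i] isT.
  by rewrite !inE !negb_or.
exists (fun i => if i == m.+1 then l else greedy a d i).
split=> [i i_lt|i i_lt|] /=; last by rewrite eqxx.
- case: (eqVneq i m.+1) => [->|ne].
    rewrite a_per l0 andbT; move: a_last; rewrite !inE.
    by case/orP => /eqP ->.
  case: i i_lt ne => [|i] _ _ /=; first by rewrite d0 d1.
  by case/and3P: (gP i) => -> ->.
- rewrite (ltn_eqF i_lt) eqSS.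
  by case: (eqVneq i m) => [->|_]; rewrite eq_sym //; case/and3P: (gP i).
Qed.

(** * Coloring the edges of a cycle with one forbidden color per vertex *)

Section Cycle.

Variable T : eqType.
Implicit Types (p s : seq T) (x y v : T).

(** The default [x] of [nth] does the wrapping: the index after the last one yields the head of the
    cycle. *)
Lemma next_consE x s v : v \in x :: s ->
  next (x :: s) v = nth x (x :: s) (index v (x :: s)).+1.
Proof. by move=> vp; rewrite next_nth vp. Qed.

Lemma next_next_neq p v : uniq p -> 2 < size p -> v \in p ->
  next p (next p v) != v.
Proof.
move=> Up p3 /[dup] vp /rot_to[i s def_p].
rewrite -!(next_rot i Up) def_p.
have : uniq (v :: s) by rewrite -def_p rot_uniq.
have : 2 < size (v :: s) by rewrite -def_p size_rot.
case: s {def_p} => [|y [|z s]] //= _; rewrite !inE !negb_or eqxx.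
move=> /andP[/and3P[vy vz _] _].
by rewrite (eq_sym y) (negbTE vy) eqxx eq_sym.
Qed.

(** Here [a v] is the color forbidden at [v], and [b v] is the color of the edge from [v] to
    [next p v]. *)
Lemma cyclic_coloring p (a : T -> 'I_4) : uniq p -> 1 < size p ->
  exists b : T -> 'I_4, {in p, forall v,
    [/\ b v != a v, b v != a (next p v) & b v != b (next p v)]}.
Proof.
move=> Up p2.
(* The edge leaving a good [y] can be colored last: either its two ends forbid the same color, or
   [a y] can be given to the following edge. *)
pose good y := (a y == a (next p y)) || (a y != a (next p (next p y))).
case: (boolP (has good p)) => [/hasP[y yp gy]|/hasPn bad]; last first.
  (* Here [a] takes two alternating values, and so does [b]. *)
  pose tau (i j : 'I_4) :=
    if i < j then fresh [:: i; j] else fresh [:: j; i; fresh [:: j; i]].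
  exists (fun v => tau (a v) (a (next p v))) => v vp.
  have := bad v vp; rewrite /good negb_or negbK => /andP[ne /eqP <-].
  move: (a v) (a (next p v)) ne => i j ij.
  have F2 k l : fresh [:: k; l] \notin [:: k; l] by exact: freshP.
  have F3 k l m : fresh [:: k; l; m] \notin [:: k; l; m] by exact: freshP.
  (* Successive edges see the pair in opposite orders, and comparing [i] with [j] makes [tau i j]
     and [tau j i] two different colors outside the pair. *)
  rewrite /tau; case: (ltngtP i j) => [lt|lt|/val_inj eq]; last 1 first.
  - by rewrite eq eqxx in ij.
  - have := F2 i j; have := F3 i j (fresh [:: i; j]).
    rewrite !inE !negb_or => /and3P[_ _ n1] /andP[n2 n3].
    by split; rewrite // eq_sym.
  - have := F2 j i; have := F3 j i (fresh [:: j; i]).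
    by rewrite !inE !negb_or => /and3P[n1 n2 n3] /andP[_ _].
rewrite /good in gy; set x := next p y in gy; set z := next p x in gy.
(* The greedy coloring starts with [d] on the edge from [x] to [z] and ends on the edge from [y] to
   [x]. *)
have [d [dx dz dy]] : exists d,
    [/\ d != a x, d != a z & a y \in [:: a x; d]].
  case: (eqVneq (a y) (a x)) gy => [->|ne] /= gy.
    exists (fresh [:: a x; a z]).
    have := @freshP [:: a x; a z] isT.
    by rewrite !inE !negb_or eqxx => /andP[-> ->].
  by exists (a y); rewrite ne gy !inE eqxx orbT.
have xp : x \in p by rewrite mem_next.
case/rot_to: (xp) => i s def_q.
have nextE v : next p v = next (x :: s) v by rewrite -def_q next_rot.
have memE v : (v \in p) = (v \in x :: s) by rewrite -def_q mem_rot.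
have Uq : uniq (x :: s) by rewrite -def_q rot_uniq.
have [m sm] : exists m, size s = m.+1.
  have := size_rot i p; rewrite def_q /=.
  by case: (size s) => [|m] eqp; [rewrite -eqp in p2 | exists m].
have sq : size (x :: s) = m.+2 by rewrite /= sm.
pose A i := a (nth x (x :: s) i).
have xs : x \in x :: s by exact: mem_head.
have yq : y \in x :: s by rewrite -memE.
have A1 : A 1 = a z.
  by rewrite /z nextE next_consE //= eqxx.
have idx_y : index y (x :: s) = m.+1.
  have : nth x (x :: s) (index y (x :: s)).+1 = x.
    by rewrite -next_consE // -nextE.
  move: yq; rewrite -index_mem sq => lt_y.
  case: (ltnP (index y (x :: s)).+1 m.+2) => [lt|]; last by lia.
  move=> eqx; have := index_uniq x (i := (index y (x :: s)).+1) (s := x :: s).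
  by rewrite sq => /(_ lt Uq); rewrite eqx /= eqxx.
have [b [b1 b2 b3]] : exists b : nat -> 'I_4,
    [/\ forall i, i < m.+2 -> (b i != A i) && (b i != A i.+1),
        forall i, i < m.+1 -> b i != b i.+1 & b m.+1 != b 0].
  apply: (@cyclic_greedy m A d) => //.
  - by rewrite /A nth_default ?sq.
  - by rewrite A1.
  - by rewrite -idx_y /A nth_index.
exists (fun v => b (index v (x :: s))) => v.
rewrite memE => vq; have lt_v : index v (x :: s) < m.+2 by rewrite -sq index_mem.
have := b1 _ lt_v; rewrite {1}/A nth_index // {1}/A -next_consE // -nextE.
case/andP => -> ->; split=> //.
rewrite nextE next_consE //.
case: (ltnP (index v (x :: s)) m.+1) => [lt|ge].
  by rewrite index_uniq ?sq //; apply: b2.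
have -> : index v (x :: s) = m.+1 by lia.
by rewrite nth_default ?sq //= eqxx.
Qed.

End Cycle.

(** * Edge sets, cycles and forests *)

Section Graph.

Variable T : finType.
Implicit Types (S P H : {set {set T}}) (f g : {set T}) (x y v : T).

(** Graphs are handled as sets of two-element sets, so that deleting edges is set difference. *)
Definition simple S : Prop := {in S, forall f, #|f| = 2}.

Definition incident S x : {set {set T}} := [set f in S | x \in f].

Lemma simple_sub S H : H \subset S -> simple S -> simple H.
Proof. by move=> /subsetP sub S2 f /sub; apply: S2. Qed.

Lemma simple_other S f x : simple S -> f \in S -> x \in f ->
  exists2 y, y != x & f = [set x; y].
Proof.
move=> S2 /S2/eqP/cards2P[u [v [uv ->]]]; rewrite !inE.
by case/orP=> /eqP ->; [exists v; rewrite // eq_sym | exists u; rewrite // setUC].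
Qed.

Lemma simple_edge_neq S x y : simple S -> [set x; y] \in S -> x != y.
Proof. by move=> S2 /S2; rewrite cards2; case: (x != y). Qed.

(** Both sides count the pairs of an edge of [S] and an end of it in [V]. *)
Lemma sum_incident S (V : {set T}) :
  \sum_(x in V) #|incident S x| = \sum_(f in S) #|f :&: V|.
Proof.
under eq_bigr => x _ do rewrite -sum1_card.
under [RHS]eq_bigr => f _ do rewrite -sum1_card.
rewrite (exchange_big_dep (mem S)) /= => [|x f _]; last first.
  by rewrite inE => /andP[].
apply: eq_bigr => f fS; apply: eq_bigl => x.
by rewrite !inE fS andbC.
Qed.

(** Grow a path at its head [x]: a neighbor of [x] other than the second vertex either lies further
    along the path and closes a cycle, or lengthens the path, which cannot exceed [#|T|]
    vertices. *)
Lemma exists_cycle (h : rel T) x0 y0 : symmetric h -> irreflexive h ->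
    h x0 y0 -> (forall x y, h x y -> exists2 z, z != y & h x z) ->
  exists p, [/\ cycle h p, uniq p & 2 < size p].
Proof.
move=> h_sym h_irr h0 h_ext.
have long k : (exists p, [/\ cycle h p, uniq p & 2 < size p]) \/
    exists x p, [/\ path h x p, uniq (x :: p) & size p = k.+1].
  elim: k => [|k [|[x [[|y p] [//= /andP[hxy hp] Up [sz]]]]]]; [right|by left|].
    exists x0, [:: y0]; rewrite /= h0 inE !andbT; split=> //.
    by apply: contraTneq h0 => ->; rewrite h_irr.
  have [z zy hxz] := h_ext _ _ hxy.
  have [zp|zp] := boolP (z \in p); [left|right].
    case/splitPr: zp hp Up {sz} => p1 p2 hp Up.
    exists [:: x, y & rcons p1 z]; split.
    - rewrite /= hxy rcons_path last_rcons h_sym hxz andbT /=.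
      by move: hp; rewrite -cat_rcons cat_path => /andP[].
    - have : uniq ([:: x, y & rcons p1 z] ++ p2) by rewrite /= cat_rcons.
      by rewrite cat_uniq => /andP[].
    - by rewrite /= size_rcons.
  exists z, [:: x, y & p]; rewrite /= h_sym hxz hxy hp sz; split=> //.
  move: Up; rewrite /= !inE !negb_or zy (negbTE zp) => -> /=.
  by rewrite !andbT; apply: contraTneq hxz => ->; rewrite h_irr.
case: (long #|T|) => [//|[x [p [_ Up sz]]]].
by have := max_card (mem (x :: p)); rewrite (card_uniqP Up) /= sz ltnNge leqnSn.
Qed.

(** The length bound rules out going back and forth along one edge. *)
Definition has_cycle H : Prop := exists p,
  [/\ cycle (fun x y => [set x; y] \in H) p, uniq p & 2 < size p].

Lemma has_cycleS H S : H \subset S -> has_cycle H -> has_cycle S.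
Proof.
move=> /subsetP sub [p [cp Up p3]]; exists p; split=> //.
by apply: sub_cycle cp => x y; apply: sub.
Qed.

(** Deleting the edge at a leaf also removes the leaf from the cover, which gives the induction.
    Without leaves, every path can be prolonged and [exists_cycle] applies. *)
Lemma forest_card H : simple H -> H != set0 ->
  has_cycle H \/ #|H| < #|cover H|.
Proof.
have [n] := ubnP #|H|; elim: n H => // n IH H le_n H2 H0.
have [leaf|noleaf] := boolP [exists x, #|incident H x| == 1].
  case/existsP: leaf => x /cards1P[f def_f].
  have : f \in incident H x by rewrite def_f set11.
  rewrite inE => /andP[fH xf].
  have subH : H :\ f \subset H by exact: subsetDl.
  have cardH := cardsD1 f H; rewrite fH in cardH.
  have [H'0|H'0] := eqVneq (H :\ f) set0.
    right; rewrite cardH H'0 cards0.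
    have : #|f| <= #|cover H| by apply/subset_leq_card/bigcup_sup.
    by rewrite H2.
  have [|cyc|lt] := IH (H :\ f) _ (simple_sub subH H2) H'0; first by card_lia.
    by left; apply: has_cycleS cyc.
  right; have : x |: cover (H :\ f) \subset cover H.
    rewrite subUset sub1set; apply/andP; split.
      by apply/bigcupP; exists f.
    apply/bigcupsP => g /setD1P[_ gH]; exact: bigcup_sup.
  move/subset_leq_card; rewrite cardsU1.
  have -> : x \notin cover (H :\ f); last by card_lia.
  apply/bigcupP => -[g /setD1P[gf gH] xg].
  have : g \in incident H x by rewrite inE gH.
  by rewrite def_f inE (negbTE gf).
left; case/set0Pn: H0 => f fH.
have /card_gt0P[x0 x0f] : 0 < #|f| by rewrite H2.
have [y0 _ def_f] := simple_other H2 fH x0f.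
apply: (@exists_cycle _ x0 y0) => [x y|x||x y hxy].
- by rewrite setUC.
- by apply: contraTF isT => /(simple_edge_neq H2); rewrite eqxx.
- by rewrite -def_f.
- have xyi : [set x; y] \in incident H x by rewrite inE hxy set21.
  have : 1 < #|incident H x|.
    have := noleaf; rewrite negb_exists => /forallP/(_ x).
    by rewrite (cardsD1 [set x; y]) xyi; card_lia.
  rewrite (cardsD1 [set x; y]) xyi ltnS => /card_gt0P[g].
  rewrite !inE => /and3P[gxy gH xg].
  have [z _ def_g] := simple_other H2 gH xg.
  exists z; last by rewrite -def_g.
  by apply: contraNneq gxy => eqz; rewrite def_g eqz.
Qed.

(** * Extending proper colorings: slack vertex, cycle, four vertices *)

Lemma proper_eq (S : {set {set T}}) (c c' : {set T} -> 'I_4) :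
  {in S, c' =1 c} -> proper_edge_coloring S c -> proper_edge_coloring S c'.
Proof. by move=> eqc c_ok f g fS gS; rewrite !eqc //; apply: c_ok. Qed.

Lemma proper_setU S H (c : {set T} -> 'I_4) :
    proper_edge_coloring S c -> proper_edge_coloring H c ->
    {in S & H, forall f g, adjacent_edges f g -> c f != c g} ->
  proper_edge_coloring (S :|: H) c.
Proof.
move=> cS cH cSH f g /setUP[fS|fH] /setUP[gS|gH]; [exact: cS|exact: cSH| |exact: cH].
move=> adj; rewrite eq_sym; apply: cSH => //.
by rewrite /adjacent_edges eq_sym setIC.
Qed.

(** Besides [f] there is at most one edge at [x] and at most two at the other end, so one of the
    four colors is free. *)
Lemma extend_slack S (c : {set T} -> 'I_4) f x : simple S ->
    (forall y, #|incident S y| <= 3) -> f \in S -> x \in f ->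
    #|incident S x| <= 2 -> proper_edge_coloring (S :\ f) c ->
  exists c' : {set T} -> 'I_4,
    proper_edge_coloring S c' /\ {in S :\ f, c' =1 c}.
Proof.
move=> S2 S3 fS xf x2 c_ok.
have [y yx def_f] := simple_other S2 fS xf.
pose N := (incident S x :\ f) :|: (incident S y :\ f).
have N3 : #|N| <= 3.
  have yf : y \in f by rewrite def_f set22.
  have := cardsD1 f (incident S x); have := cardsD1 f (incident S y).
  rewrite !inE fS xf yf /=; have := S3 y.
  have [+ _] := leq_card_setU (incident S x :\ f) (incident S y :\ f).
  by rewrite -/N; card_lia.
pose s := [seq c g | g <- enum N].
have fr : fresh s \notin s by apply: freshP; rewrite size_map -cardE.
pose c' g := if g == f then fresh s else c g.
have c'E : {in S :\ f, c' =1 c}.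
  by move=> g; rewrite /c' !inE => /andP[/negbTE ->].
exists c'; split=> //; rewrite -(setD1K fS); apply: proper_setU.
- by move=> ? ? /set1P -> /set1P ->; rewrite /adjacent_edges eqxx.
- exact: proper_eq c_ok.
move=> _ g /set1P -> gS /andP[fg /set0Pn[z]].
rewrite (c'E _ gS) /c' eqxx {1}def_f !inE => /andP[zf zg].
apply: contraNneq fr => ->; apply: map_f; rewrite mem_enum !inE.
by case/setD1P: gS => -> ->; case/orP: zf => /eqP <-; rewrite zg ?orbT.
Qed.

(** Two of the at most three edges at a cycle vertex lie in [C], so at most one colored edge,
    possibly a chord, constrains the cycle edges there. *)
Lemma extend_cycle S p (c : {set T} -> 'I_4) : simple S ->
    (forall y, #|incident S y| <= 3) ->
    uniq p -> 2 < size p ->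
    let C := [set [set v; next p v] | v in p] in
    C \subset S -> proper_edge_coloring (S :\: C) c ->
  exists c' : {set T} -> 'I_4,
    proper_edge_coloring S c' /\ {in S :\: C, c' =1 c}.
Proof.
move=> S2 S3 Up p3 C /subsetP CS c_ok.
have nn v : v \in p -> next p (next p v) != v by exact: next_next_neq.
have next_inj v w : next p v = next p w -> v = w.
  by move/(congr1 (prev p)); rewrite !prev_next.
have CP v : v \in p -> [set v; next p v] \in C by move=> vp; apply: imset_f.
have edge_inj v w : v \in p -> w \in p ->
    [set v; next p v] = [set w; next p w] -> v = w.
  move=> vp wp eq.
  have := set21 v (next p v); rewrite eq !inE => /orP[/eqP//|/eqP v_nw].
  have := set21 w (next p w); rewrite -eq !inE => /orP[/eqP//|/eqP w_nv].
  by have := nn _ wp; rewrite -v_nw -w_nv eqxx.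
(* The color forbidden at [v] by its only edge outside the cycle; [ord0] is
   used when there is none, which only forbids more. *)
pose a v := odflt ord0 (omap c [pick g in S :\: C | v \in g]).
have aP v g : v \in p -> g \in S :\: C -> v \in g -> a v = c g.
  move=> vp gSC vg; rewrite /a; case: pickP => [g'|/(_ g)]; last by rewrite gSC vg.
  move=> /andP[g'SC vg'] /=; congr c; apply/eqP/negPn/negP => ne.
  (* With the two cycle edges at [v], distinct [g] and [g'] would make four edges at [v]. *)
  set f1 := [set v; next p v]; set f2 := [set prev p v; next p (prev p v)].
  have f1C : f1 \in C by apply: CP.
  have f2C : f2 \in C by apply: CP; rewrite mem_prev.
  have f12 : f1 != f2.
    apply/eqP => /edge_inj; rewrite mem_prev => /(_ vp vp) eqv.
    have nv : next p v = v by rewrite {1}eqv next_prev.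
    by have := nn _ vp; rewrite !nv eqxx.
  have vf2 : v \in f2 by rewrite /f2 next_prev // set22.
  have sub : [set f1; f2] :|: [set g; g'] \subset incident S v.
    apply/subsetP => h; rewrite !inE -!orbA.
    case/setDP: gSC => gS _; case/setDP: g'SC => g'S _.
    by case/or4P => /eqP ->;
      rewrite ?gS ?g'S ?(CS _ f1C) ?(CS _ f2C) ?vg ?vg' ?vf2 ?set21.
  have := leq_trans (subset_leq_card sub) (S3 v).
  rewrite cardsU !cards2 f12 eq_sym ne.
  suff -> : [set f1; f2] :&: [set g; g'] = set0 by rewrite cards0.
  apply/setP => h; rewrite !inE; apply/negP => /andP[/orP[]/eqP-> /orP[]/eqP eqh];
    by move: gSC g'SC; rewrite -eqh !inE ?f1C ?f2C.
have [b bP] := cyclic_coloring a Up (ltnW p3).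
pose c' f := odflt (c f) (omap b [pick v in p | f == [set v; next p v]]).
have c'C v : v \in p -> c' [set v; next p v] = b v.
  move=> vp; rewrite /c'; case: pickP => [w /andP[wp /eqP /edge_inj ->]|/(_ v)] //.
  by rewrite vp eqxx.
have c'E : {in S :\: C, c' =1 c}.
  move=> f /setDP[_ fC]; rewrite /c'; case: pickP => //= v /andP[vp /eqP def_f].
  by rewrite def_f CP in fC.
exists c'; split=> //.
have -> : S = C :|: (S :\: C).
  by apply/setP => f; rewrite !inE; case: (boolP (f \in C)) => // /CS.
apply: proper_setU; last 1 first.
- move=> f g /imsetP[v vp ->] gSC /andP[_ /set0Pn[u]]; rewrite c'C // c'E //.
  have [bv bnv _] := bP v vp.
  have np : next p v \in p by rewrite mem_next.
  rewrite !inE => /andP[/orP[]/eqP -> ug].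
    by rewrite -(aP _ _ vp gSC ug).
  by rewrite -(aP _ _ np gSC ug).
- move=> f g /imsetP[v vp ->] /imsetP[w wp ->] /andP[fg /set0Pn[u]].
  rewrite !c'C // !inE => /andP[/orP[]/eqP -> /orP[]/eqP eqvw].
  + by rewrite eqvw eqxx in fg.
  + by rewrite eqvw eq_sym; case: (bP w wp).
  + by rewrite -eqvw; case: (bP v vp).
  + by rewrite (next_inj _ _ eqvw) eqxx in fg.
- exact: proper_eq c_ok.
Qed.

(* Opposite edges of the [K_4] get the same color, and a fourth color goes to
   the pair missed by [P]; there is at most one such pair since [#|P| = 3]. *)
Lemma extend_K4 S P (V : {set T}) (c0 : {set T} -> 'I_4) : simple S ->
    #|V| = 4 -> P \subset S -> #|P| = 3 -> {in S, forall f, f \subset V} ->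
    proper_edge_coloring P c0 ->
  exists c : {set T} -> 'I_4, proper_edge_coloring S c /\ {in P, c =1 c0}.
Proof.
move=> S2 V4 /subsetP PS P3 SV c0_ok.
pose s := [seq c0 g | g <- enum P].
have fr : fresh s \notin s by apply: freshP; rewrite size_map -cardE P3.
have frP g : g \in P -> c0 g != fresh s.
  by move=> gP; apply: contraNneq fr => <-; apply: map_f; rewrite mem_enum.
pose c f := if f \in P then c0 f
            else if V :\: f \in P then c0 (V :\: f) else fresh s.
have opp f : f \in S -> #|V :\: f| = 2.
  by move=> fS; rewrite cardsD (setIidPr (SV _ fS)) V4 S2.
have oppK f : f \in S -> V :\: (V :\: f) = f.
  by move=> fS; rewrite setDDr setDv set0U (setIidPr (SV _ fS)).
have meet f g : f \subset V -> g \subset V -> #|f| = 2 -> #|g| = 2 ->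
    g != V :\: f -> f :&: g != set0.
  move=> fV gV f2 g2; apply: contraNneq => fg0.
  rewrite eqEcard subsetD gV disjoint_sym -setI_eq0 fg0 eqxx /=.
  by rewrite cardsD (setIidPr fV) V4 f2 g2.
have cP f : f \in S -> (exists f', [/\ f' \in P, c f = c0 f' &
      f' = f \/ f' = V :\: f]) \/
    [/\ f \notin P, V :\: f \notin P & c f = fresh s].
  move=> fS; rewrite /c; case: ifP => fP; first by left; exists f; split=> //; left.
  case: ifP => oP; first by left; exists (V :\: f); split=> //; right.
  by right.
exists c; split; last by move=> f fP; rewrite /c fP.
move=> f g fS gS /andP[fg meet_fg].
have gof : g != V :\: f.
  apply: contraNneq meet_fg => ->; apply/eqP/setP => z; rewrite !inE.
  by case: (z \in f).
have fog : f != V :\: g by apply: contraNneq gof => ->; rewrite oppK.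
have ofog : V :\: f != V :\: g.
  by apply: contraNneq fg => eqo; rewrite -(oppK f) // eqo oppK.
have [[f' [f'P -> f'E]]|[fP oP ->]] := cP f fS;
  have [[g' [g'P -> g'E]]|[gP ogP ->]] := cP g gS; last 1 first.
(* If both edges had the fresh color, [P] and two full opposite pairs would be seven of the six
   pairs in [V]. *)
- pose D := [set A : {set T} | A \subset V & #|A| == 2].
  have D6 : #|D| = 6 by rewrite cards_draws V4.
  pose Q := [set f; V :\: f] :|: [set g; V :\: g].
  have sub : P :|: Q \subset D.
    apply/subsetP => h; rewrite !inE -!orbA => /or4P[/PS hS|/eqP->|/eqP->|].
    + by rewrite SV // S2.
    + by rewrite SV // S2.
    + by rewrite subsetDl opp.
    + by case/orP => /eqP ->; rewrite ?subsetDl ?opp // SV // S2.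
  have := subset_leq_card sub; rewrite D6.
  have neo h : h \in S -> h != V :\: h.
    move=> hS; apply/eqP => eqh; have /card_gt0P[z zh] : 0 < #|h| by rewrite S2.
    by move: (zh); rewrite eqh inE zh.
  have Q4 : #|Q| = 4.
    rewrite cardsU !cards2 !neo //.
    suff -> : [set f; V :\: f] :&: [set g; V :\: g] = set0 by rewrite cards0.
    apply/setP => h; rewrite !inE; apply/negP => /andP[/orP[]/eqP-> /orP[]/eqP eqh].
    + by rewrite eqh eqxx in fg.
    + by rewrite eqh eqxx in fog.
    + by rewrite eqh eqxx in gof.
    + by rewrite eqh eqxx in ofog.
  rewrite cardsU P3 Q4.
  suff -> : P :&: Q = set0 by rewrite cards0.
  apply/setP => h; rewrite !inE; apply/negP => /andP[hP].
  by rewrite -!orbA => /or4P[]/eqP eqh; rewrite -eqh hP in fP oP gP ogP.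
(* As [f] and [g] are neither equal nor opposite, the same holds for [f'] and [g'], which are
   therefore adjacent. *)
- apply: c0_ok => //; apply/andP; split.
    by case: f'E g'E => -> [] ->; rewrite // eq_sym.
  have half h h' : h \in S -> h' = h \/ h' = V :\: h -> (h' \subset V) && (#|h'| == 2).
    by move=> hS [] ->; rewrite ?subsetDl ?opp // SV // S2.
  have /andP[f'V /eqP f'2] := half _ _ fS f'E.
  have /andP[g'V /eqP g'2] := half _ _ gS g'E.
  by apply: meet => //; case: f'E g'E => -> [] ->; rewrite ?oppK // eq_sym.
- exact: frP.
- by rewrite eq_sym frP.
Qed.

(** * Counting in the forest case *)

(** A forest has [v] vertices and [h] edges; [p] edges are precolored, [q] of them inside the
    forest's vertex set, which meets them in [s] ends. The degree sum gives
    [3 * v <= 2 * (v - 1) + 6], and the number of vertex pairs excludes [v < 4]. *)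
Lemma forest_arith (v h s p q : nat) :
    h + q <= 'C(v, 2) -> 3 * v = 2 * h + s -> s <= p + q -> h < v -> 0 < h ->
    q <= p -> p <= 3 ->
  [/\ v = 4, p = 3 & q = 3].
Proof.
move=> hq eq_s le_s hv h0 qp p3; have v4 : v <= 4 by lia.
case: v v4 hq eq_s hv => [|[|[|[|[|v]]]]] // _; rewrite ?bin1 ?binS ?bin0 ?bin0n /=;
  by split; lia.
Qed.

(** In the degree sum over [V] an edge of [H] counts twice, and a precolored edge at most once
    unless it lies inside [V]. *)
Lemma tight_forest_card H P (V := cover H) : simple (H :|: P) ->
    [disjoint H & P] -> #|P| <= 3 -> H != set0 -> #|H| < #|V| ->
    {in V, forall x, #|incident (H :|: P) x| = 3} ->
  [/\ #|V| = 4, #|P| = 3 & {in P, forall f, f \subset V}].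
Proof.
move=> S2 dis P3 H0 HV tight.
pose Pin := [set f in P | f \subset V].
have H2 : simple H by apply: simple_sub S2; apply: subsetUl.
have P2 : simple P by apply: simple_sub S2; apply: subsetUr.
have HsV f : f \in H -> f \subset V by move=> fH; apply: bigcup_sup.
have eq_sum : 3 * #|V| = 2 * #|H| + \sum_(f in P) #|f :&: V|.
  have -> : 3 * #|V| = \sum_(x in V) #|incident (H :|: P) x|.
    by rewrite (eq_bigr (fun=> 3)) // sum_nat_const mulnC.
  rewrite sum_incident (eq_bigl [in [predU H & P]]) => [|f]; last by rewrite !inE.
  rewrite bigU //=; congr (_ + _).
  rewrite (eq_bigr (fun=> 2)) ?sum_nat_const 1?mulnC // => f fH.
  by rewrite (setIidPl (HsV f fH)) H2.
have le_sum : \sum_(f in P) #|f :&: V| <= #|P| + #|Pin|.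
  have -> : #|P| + #|Pin| = \sum_(f in P) (1 + (f \subset V)).
    rewrite big_split /= sum1_card; congr (_ + _).
    rewrite -sum1_card big_mkcond [RHS]big_mkcond; apply: eq_bigr => f _.
    by rewrite inE; case: (f \in P); case: (f \subset V).
  apply: leq_sum => f fP; have f2 := P2 f fP.
  case: (boolP (f \subset V)) => [fV|fV]; first by rewrite (setIidPl fV) f2.
  rewrite addn0 -ltnS -f2; apply: proper_card.
  by rewrite properEneq subsetIl andbT; apply: contra fV => /eqP/setIidPl.
have in_V : #|H| + #|Pin| <= 'C(#|V|, 2).
  rewrite -cards_draws -cardsUI.
  suff -> : H :&: Pin = set0.
    rewrite cards0 addn0; apply/subset_leq_card/subsetP => f; rewrite !inE.
    case/orP => [fH|/andP[fP ->]]; first by rewrite HsV // H2.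
    by rewrite P2.
  apply/setP => f; rewrite !inE; apply/negP => /and3P[fH fP _].
  by rewrite (disjointFr dis fH) in fP.
have Pin_le : #|Pin| <= #|P|.
  by apply/subset_leq_card/subsetP => f; rewrite inE => /andP[].
have H_gt0 : 0 < #|H| by rewrite card_gt0.
have [V4 P3' Pin3] := forest_arith in_V eq_sum le_sum HV H_gt0 Pin_le P3.
split=> // f fP; have /eqP def_P : Pin == P.
  rewrite eqEcard Pin3 P3' andbT; apply/subsetP => g.
  by rewrite inE => /andP[].
by move: fP; rewrite -def_P inE => /andP[].
Qed.

(** * The induction on edge sets *)

Lemma extend_precoloring P S (c0 : {set T} -> 'I_4) : P \subset S ->
    #|P| <= 3 -> proper_edge_coloring P c0 ->
    simple S -> (forall x, #|incident S x| <= 3) ->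
  exists c : {set T} -> 'I_4, proper_edge_coloring S c /\ {in P, c =1 c0}.
Proof.
move=> PS P3 c0_ok; have [n] := ubnP #|S|.
elim: n S PS => // n IH S PS le_n S2 S3.
have IHD (C : {set {set T}}) : C \subset S :\: P -> C != set0 ->
    exists c : {set T} -> 'I_4,
      proper_edge_coloring (S :\: C) c /\ {in P, c =1 c0}.
  move=> CSP C0; apply: IH.
  - rewrite subsetD PS /=; move: CSP; rewrite subsetD => /andP[_].
    by rewrite disjoint_sym.
  - have CS : C \subset S by apply: subset_trans CSP (subsetDl _ _).
    rewrite -ltnS (leq_trans _ le_n) // ltnS cardsD (setIidPr CS).
    have := subset_leq_card CS; rewrite -card_gt0 in C0; card_lia.
  - by apply: simple_sub S2; apply: subsetDl.
  - move=> x; apply: leq_trans (S3 x); apply/subset_leq_card/subsetP => f.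
    by rewrite !inE -andbA => /and3P[_ -> ->].
have keep (C : {set {set T}}) (c c' : {set T} -> 'I_4) :
    C \subset S :\: P -> {in P, c =1 c0} ->
    {in S :\: C, c' =1 c} -> {in P, c' =1 c0}.
  move=> CSP cc0 c'c f fP; rewrite c'c ?cc0 // inE (subsetP PS) // andbT.
  by apply: contraL fP => /(subsetP CSP); rewrite inE => /andP[].
pose H := S :\: P.
have [H0|H0] := eqVneq H set0.
  exists c0; split=> //; suff -> : S = P by [].
  by apply/eqP; rewrite eqEsubset PS andbT -setD_eq0 -/H H0.
(* Past this case, every end of an uncolored edge has degree exactly three. *)
have [slack|tight] := boolP [exists x in cover H, #|incident S x| <= 2].
  case/exists_inP: slack => x /bigcupP[f fH xf] x2.
  have fSP : [set f] \subset S :\: P by rewrite sub1set.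
  have [||c [c_ok cc0]] := IHD [set f] => //.
    by apply/set0Pn; exists f; rewrite inE.
  have fS : f \in S by case/setDP: fH.
  have [c' [c'_ok c'c]] := extend_slack S2 S3 fS xf x2 c_ok.
  by exists c'; split=> //; apply: keep c'c.
have H2 : simple H by apply: simple_sub S2; apply: subsetDl.
have [[p [cyc_p Up p3]]|HV] := forest_card H2 H0.
  pose C := [set [set v; next p v] | v in p].
  have CH : C \subset H.
    by apply/subsetP => f /imsetP[v vp ->]; apply: (next_cycle cyc_p).
  have CS : C \subset S by apply: subset_trans CH (subsetDl _ _).
  have [||c [c_ok cc0]] := IHD C => //.
    case: p p3 {cyc_p Up CH CS} @C => // v p _ /=; apply/set0Pn.
    by exists [set v; next (v :: p) v]; apply: imset_f; rewrite mem_head.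
  have [c' [c'_ok c'c]] := extend_cycle S2 S3 Up p3 CS c_ok.
  by exists c'; split=> //; apply: keep c'c.
have def_S : H :|: P = S.
  apply/setP => f; rewrite !inE.
  by case: (boolP (f \in P)) => [/(subsetP PS) ->|_]; rewrite ?orbT ?orbF.
have [|||V4 P3' PV] := @tight_forest_card H P _ _ P3 H0 HV.
- by rewrite def_S.
- by rewrite /H -setI_eq0 setIDAC setDIl setDv setI0.
- move=> x xV; rewrite def_S; apply/eqP; rewrite eqn_leq S3 ltnNge.
  by move: tight; rewrite negb_exists_in => /forall_inP/(_ x xV).
(* Uncolored and precolored edges all lie in the four-element [cover H], so [S] is part of a
   [K_4]. *)
apply: (extend_K4 S2 V4 PS P3') => // f.
by rewrite -def_S inE => /orP[fH|]; [apply: bigcup_sup|apply: PV].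
Qed.

End Graph.

Theorem theorem4 (T : finType) (e : rel T)
    (e_sym : symmetric e) (e_irrefl : irreflexive e) (e_subcubic : subcubic e)
    (P : {set {set T}}) (c0 : {set T} -> 'I_4)
    (P_edges : P \subset edges e) (P_le3 : #|P| <= 3)
    (c0_proper : proper_edge_coloring P c0) :
  exists c : {set T} -> 'I_4,
    proper_edge_coloring (edges e) c /\ {in P, c =1 c0}.
Proof.
have edgeP f : reflect (exists x y, e x y /\ f = [set x; y]) (f \in edges e).
  apply: (iffP imset2P) => [[x y _ + ->]|[x [y [exy ->]]]].
    by rewrite inE => /andP[_ exy]; exists x, y.
  by exists x y; rewrite ?inE ?exy.
apply: extend_precoloring => // [f /edgeP[x [y [exy ->]]]|x].
  by rewrite cards2; case: eqP exy => // ->; rewrite e_irrefl.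
apply: leq_trans (leq_trans (leq_bigmax x) e_subcubic).
(* Each edge at [x] comes from a neighbor of [x], so [degree e x] bounds their number. *)
have sub : incident (edges e) x \subset [set [set x; y] | y in [set y | e x y]].
  apply/subsetP => f; rewrite inE => /andP[/edgeP[u [v [euv ->]]]].
  rewrite !inE => /orP[]/eqP eqx; subst x.
    by apply: imset_f; rewrite inE.
  by rewrite setUC; apply: imset_f; rewrite inE e_sym.
by apply: leq_trans (subset_leq_card sub) (leq_imset_card _ _).
Qed.
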